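(* Let $n\geq 2$ be an integer. Modulo isometries, there is a unique free boundary $n$-catenoid $\Sigma_n\subset B^{n+1}(1)$; that is, a free boundary $n$-catenoid in $B^{n+1}(1)$ exists, and any two free boundary $n$-catenoids in $B^{n+1}(1)$ are related by a linear isometry of $\mathbb{R}^{n+1}$.
   Context: $B^{n+1}(1)$ is the closed unit ball in $\mathbb{R}^{n+1}$ centered at the origin. An $n$-catenoid is a complete, nonplanar minimal hypersurface of revolution $S$ in $\mathbb{R}^{n+1}$: there is a line $\ell$ (its axis of rotation; not required to pass through the origin) such that $S$ is invariant under all rotations of $\mathbb{R}^{n+1}$ fixing $\ell$ pointwise. Explicitly, up to a rigid motion and a dilation of $\mathbb{R}^{n+1}$, $S$ is the hypersurface $\{(z,r(z)\omega): z\in(-T,T),\ \omega\in S^{n-1}\}\subset\mathbb{R}\times\mathbb{R}^n$ (axis $\mathbb{R}\times\{0\}$), where $r$ is the maximal solution of $\ddot r\, r-(n-1)(1+\dot r^2)=0$, $r(0)=1$, $\dot r(0)=0$ (with $T=\infty$ if $n=2$ and $T<\infty$ if $n>2$). A free boundary $n$-catenoid in $B^{n+1}(1)$ is a nonempty set $\Sigma=S\cap B^{n+1}(1)$, where $S$ is an $n$-catenoid that meets the unit sphere $\partial B^{n+1}(1)$ orthogonally at every point of $S\cap\partial B^{n+1}(1)$; thus $\Sigma$ is a minimal hypersurface with $\partial\Sigma\subset\partial B^{n+1}(1)$ meeting $\partial B^{n+1}(1)$ orthogonally along $\partial\Sigma$. *)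

(* Defs.v *)
From HB Require Import structures.
From mathcomp Require Import all_boot all_order all_algebra.
From mathcomp Require Import all_classical all_reals all_analysis.

Set Implicit Arguments.
Unset Strict Implicit.
Unset Printing Implicit Defensive.

Import Order.TTheory GRing.Theory Num.Theory.
Import numFieldNormedType.Exports.

Local Open Scope classical_set_scope.
Local Open Scope ring_scope.

(* R^m is 'rV[R]_m.  The library norm on row vectors is the sup norm; it induces
   the usual topology and derivatives, but metric notions below must use the
   Euclidean norm [enorm]. *)

Definition dot (R : realType) (m : nat) (u v : 'rV[R]_m) : R :=
  \sum_(i < m) u 0 i * v 0 i.

Definition enorm (R : realType) (m : nat) (u : 'rV[R]_m) : R :=
  Num.sqrt (dot u u).

Definition unit_ball (R : realType) (m : nat) : set 'rV[R]_m :=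
  [set x | enorm x <= 1].

Definition unit_sphere (R : realType) (m : nat) : set 'rV[R]_m :=
  [set x | enorm x = 1].

Definition linear_isometry (R : realType) (m : nat)
    (L : {linear 'rV[R]_m -> 'rV[R]_m}) : Prop :=
  forall x, enorm (L x) = enorm x.

(* Tangent vectors are velocities of curves lying in S; for an embedded
   submanifold S this is the usual tangent space at p. *)
Definition tangent (R : realType) (m : nat) (S : set 'rV[R]_m.+1)
    (p v : 'rV[R]_m.+1) : Prop :=
  exists g : R -> 'rV[R]_m.+1,
    [/\ g 0 = p, (\forall t \near (0 : R), S (g t)) & is_derive (0 : R) 1 g v].

Definition normal (R : realType) (m : nat) (S : set 'rV[R]_m.+1)
    (p u : 'rV[R]_m.+1) : Prop :=
  forall v, tangent S p v -> dot u v = 0.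

Definition meet_orthogonally (R : realType) (m : nat) (S S' : set 'rV[R]_m.+1)
    (p : 'rV[R]_m.+1) : Prop :=
  forall u u', normal S p u -> normal S' p u' -> dot u u' = 0.

(* The equation of a minimal hypersurface of revolution with profile curve r.
   I is open, so the values of r outside I are irrelevant. *)
Definition profile_solution (R : realType) (n : nat) (I : set R) (r : R -> R)
    : Prop :=
  [/\ open I, is_interval I, I 0, r 0 = 1 /\ r^`()%classic 0 = 0
    & forall z, I z ->
      [/\ derivable r z 1, derivable (r^`()%classic) z 1
        & r^`(2)%classic z * r z
          - (n%:R - 1) * (1 + r^`()%classic z ^+ 2) = 0]].

Definition sym_itv (R : realType) (T : \bar R) : set R :=
  [set z : R | (- T < z%:E)%E /\ (z%:E < T)%E].

(* T = +oo if n = 2, and T is finite if n > 2. *)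
Definition maximal_profile (R : realType) (n : nat) (T : \bar R) (r : R -> R)
    : Prop :=
  profile_solution n (sym_itv T) r /\
  forall (J : set R) (s : R -> R), profile_solution n J s ->
    sym_itv T `<=` J -> (forall z, sym_itv T z -> s z = r z) ->
    J `<=` sym_itv T.

(* R x R^n is identified with R^(n+1), the axis of rotation being R x {0}. *)
Definition axis_point (R : realType) (n : nat) (z : R) (y : 'rV[R]_n)
    : 'rV[R]_n.+1 :=
  row_mx (z%:M : 'rV[R]_1) y.

Definition profile_catenoid (R : realType) (n : nat) (T : \bar R) (r : R -> R)
    : set 'rV[R]_n.+1 :=
  [set x | exists z (w : 'rV[R]_n),
    [/\ sym_itv T z, enorm w = 1 & x = axis_point z (r z *: w)]].

(* The complete nonplanar minimal hypersurfaces of revolution, described as the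
   images of the model under rigid motions and dilations; the axis need not
   pass through the origin. *)
Definition catenoid (R : realType) (n : nat) (S : set 'rV[R]_n.+1) : Prop :=
  exists (T : \bar R) (r : R -> R) (c : R)
         (L : {linear 'rV[R]_n.+1 -> 'rV[R]_n.+1}) (b : 'rV[R]_n.+1),
    [/\ maximal_profile n T r, 0 < c, linear_isometry L
      & S = [set c *: L x + b | x in @profile_catenoid R n T r]].

Definition free_boundary_catenoid (R : realType) (n : nat)
    (Sigma : set 'rV[R]_n.+1) : Prop :=
  exists S : set 'rV[R]_n.+1,
    [/\ catenoid S,
        (forall p, S p -> unit_sphere p -> meet_orthogonally S (@unit_sphere R n.+1) p),
        Sigma = S `&` @unit_ball R n.+1
      & Sigma !=set0].

(* Main.v *)
Require Import Defs.
From mathcomp Require Import all_boot all_order all_algebra.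
From mathcomp Require Import all_classical all_reals all_analysis.
From mathcomp Require Import ring lra.
Import Order.TTheory GRing.Theory Num.Theory.
Import numFieldNormedType.Exports.
Local Open Scope classical_set_scope.
Local Open Scope ring_scope.

(** Put m = n - 1 and parametrize the profile curve by its slope p = r'. The
    equation r r'' = m (1 + r'^2) becomes r = (1 + p^2)^(1/2m) =: rho(p) and
    dz/dp = rho / (m (1 + p^2)), so the catenoid is the set of the points
    (Z(p), rho(p) w) with w a unit vector and Z an odd antiderivative; any
    solution r satisfies rho(r'(z)) = r(z) and Z(r'(z)) = z, because the
    derivatives of rho(r') / r and Z(r') - z vanish.

    After a similarity the catenoid is this model and the sphere has an
    arbitrary centre (a, y) and radius R. Since (-p, w) is normal, orthogonality
    says rho - w.y = p (Z - a) at every common point. If y <> 0, the values of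
    w.y sweep out an interval, so along an open interval of p the function
    (Z - a)^2 - rho^2 + 2 p rho (Z - a) + |y|^2 - R^2 vanishes; its derivative
    has the sign of Z - a, which is absurd. If y = 0, the sphere cuts the profile
    at some p1 < 0 < p2, and there E(p) = rho^2 - Z^2 + 2 Z rho / p takes the
    same value R^2 - a^2. As E is even and increasing for p > 0, p1 = - p2, hence
    a = 0. Finally p Z = rho has exactly one positive root, since
    d(p Z - rho)/dp = Z. *)

(** * Derivatives, the mean value theorem and antiderivatives on the real line *)

Lemma is_derive_congr {R : realType} {f : R -> R} {x : R} (a : R) {b : R} :
  is_derive x 1 f a -> a = b -> is_derive x 1 f b.
Proof. by move=> ? <-. Qed.

Lemma is_derive_add {R : realType} {f g : R -> R} {x a b : R} :
  is_derive x 1 f a -> is_derive x 1 g b ->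
  is_derive x 1 (fun y => f y + g y) (a + b).
Proof. by move=> *; exact: is_deriveD. Qed.

Lemma is_derive_sub {R : realType} {f g : R -> R} {x a b : R} :
  is_derive x 1 f a -> is_derive x 1 g b ->
  is_derive x 1 (fun y => f y - g y) (a - b).
Proof. by move=> *; exact: is_deriveB. Qed.

Lemma is_derive_opp {R : realType} {f : R -> R} {x a : R} :
  is_derive x 1 f a -> is_derive x 1 (fun y => - f y) (- a).
Proof. by move=> *; exact: is_deriveN. Qed.

Lemma is_derive_mul {R : realType} {f g : R -> R} {x a b : R} :
  is_derive x 1 f a -> is_derive x 1 g b ->
  is_derive x 1 (fun y => f y * g y) (a * g x + f x * b).
Proof.
move=> fa gb; apply: (is_derive_congr _ (is_deriveM fa gb)).
by rewrite addrC /GRing.scale /= [a * _]mulrC.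
Qed.

Lemma is_derive_sqr {R : realType} {f : R -> R} {x a : R} :
  is_derive x 1 f a -> is_derive x 1 (fun y => f y ^+ 2) (2 * f x * a).
Proof.
move=> fa; apply: (is_derive_congr (a * f x + f x * a)); last by ring.
exact: is_derive_mul.
Qed.

Lemma is_derive_inv {R : realType} {f : R -> R} {x a : R} :
  f x != 0 -> is_derive x 1 f a ->
  is_derive x 1 (fun y => (f y)^-1) (- a / f x ^+ 2).
Proof.
move=> fx0 fa; apply: (is_derive_congr _ (is_deriveV fx0 fa)).
by rewrite /GRing.scale /= mulrC mulNr mulrN.
Qed.

Lemma is_derive_comp {R : realType} {f g : R -> R} {x a b : R} :
  is_derive (g x) 1 f a -> is_derive x 1 g b ->
  is_derive x 1 (fun y => f (g y)) (a * b).
Proof. move=> fa gb; exact: is_derive1_comp. Qed.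

(* [is_derive] is a type class; [notypeclasses refine] keeps instance search
   from choosing the shape of the derivative. *)
Ltac is_derive_tac := repeat first
  [ match goal with
    | H : forall z, is_derive z 1 ?f _ |- is_derive _ 1 ?f _ =>
        notypeclasses refine (H _)
    | H : is_derive ?z 1 ?f _ |- is_derive ?z 1 ?f _ => notypeclasses refine H
    | H : is_derive ?z 1 ?f _ |- is_derive ?z 1 (fun y => ?f y) _ =>
        notypeclasses refine H
    | H : forall z, is_derive z 1 ?f _ |- is_derive _ 1 (fun y => ?f y) _ =>
        notypeclasses refine (H _)
    end
  | notypeclasses refine (is_derive_cst _ _ _)
  | notypeclasses refine (is_derive_id _ _)
  | notypeclasses refine (is_derive_add _ _)
  | notypeclasses refine (is_derive_sub _ _)
  | notypeclasses refine (is_derive_opp _)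
  | notypeclasses refine (is_derive_sqr _)
  | notypeclasses refine (is_derive_mul _ _) ].

Ltac is_derive_by := notypeclasses refine (is_derive_congr _ _ _); [is_derive_tac|cbv beta].

Lemma is_derive_continuous {R : realType} {f : R -> R} {x a : R} :
  is_derive x 1 f a -> {for x, continuous f}.
Proof. by move=> fa; apply/differentiable_continuous/derivable1_diffP. Qed.

Lemma mean_value {R : realType} (f df : R -> R) {x y : R} : x < y ->
  (forall z, x <= z <= y -> is_derive z 1 f (df z)) ->
  exists2 c, x < c < y & f y - f x = df c * (y - x).
Proof.
move=> xy dfP; have [||c] := @MVT R f df x y xy.
- move=> z; rewrite in_itv/= => /andP[? ?]; apply: dfP.
  by rewrite !ltW.
- apply: derivable_within_continuous => z; rewrite in_itv/= => zxy.
  by have [] := dfP z zxy.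
- by rewrite in_itv /= => cxy fE; exists c.
Qed.

Lemma increasing_of_derive {R : realType} (f df : R -> R) {x y : R} : x < y ->
  (forall z, x <= z <= y -> is_derive z 1 f (df z)) ->
  (forall z, x < z < y -> 0 < df z) -> f x < f y.
Proof.
move=> xy fdf df0; have [c cxy fE] := mean_value f df xy fdf.
by rewrite -subr_gt0 fE mulr_gt0 ?df0 ?subr_gt0.
Qed.

Lemma constant_of_derive {R : realType} (I : set R) (f : R -> R) :
  is_interval I -> (forall z, I z -> is_derive z 1 f 0) ->
  forall x y, I x -> I y -> f x = f y.
Proof.
move=> itvI f0; suff H x y : x < y -> I x -> I y -> f x = f y.
  by move=> x y Ix Iy; have [/H->|/H->|->] := ltgtP x y.
move=> xy Ix Iy; have [z xzy|c _] := @mean_value R f (fun=> 0) x y xy.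
  by apply: f0; exact: itvI xzy.
by rewrite mul0r => /eqP; rewrite subr_eq0 => /eqP->.
Qed.

Lemma continuous_IVT {R : realType} (f : R -> R) (a b v : R) : a <= b ->
  continuous f -> (f a <= v <= f b) || (f b <= v <= f a) ->
  exists2 c, a <= c <= b & f c = v.
Proof.
move=> ab cf fv; have [||c] := @IVT R f a b v ab.
- exact: continuous_subspaceT.
- by rewrite ge_min le_max; case/orP: fv => /andP[-> ->]; rewrite ?orbT.
- by rewrite in_itv /=; exists c.
Qed.

(** Integration from -N gives an antiderivative on (-N, N), normalized to vanish at 0. Two of these
    differ by a constant on their common domain, so they agree there and can be glued. *)
Lemma exists_antiderivative {R : realType} (f : R -> R) : continuous f ->
  exists F : R -> R, F 0 = 0 /\ forall x : R, is_derive x 1 F (f x).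
Proof.
move=> cf; pose mu := (@lebesgue_measure R).
have local (N : R) : exists F : R -> R,
    F 0 = 0 /\ (forall x, - N < x < N -> is_derive x 1 F (f x)).
  pose G (x : R) := (\int[mu]_(t in [set` `[- N, x]%R]) f t)%R.
  have dG x : - N < x < N -> is_derive x 1 G (f x).
    move=> /andP[Nx xN].
    have [||||dG GE] := @continuous_FTC1_closed R f (- N) x N.
    - exact: xN.
    - apply: continuous_compact_integrable; first exact: segment_compact.
      exact: continuous_subspaceT.
    - exact: Nx.
    - exact: cf.
    - by split => //; rewrite -derive1E.
  exists (fun x => G x - G 0); split; first by rewrite subrr.
  move=> x /dG dGx; is_derive_by.
  by rewrite addr0.
have [F FP] := choice local.
have F_agree (M N x : R) : `|x| < M -> `|x| < N -> F M x = F N x.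
  move=> xM xN; have [[FM0 dFM] [FN0 dFN]] := (FP M, FP N).
  have := @constant_of_derive R [set x | `|x| < M /\ `|x| < N]
    (fun x => F M x - F N x) _ _ x 0.
  rewrite FM0 FN0 subrr => FMN; apply/eqP; rewrite -subr_eq0; apply/eqP.
  apply: FMN.
  - move=> a b [+ +] [+ +] c /andP[ac cb] /=.
    by rewrite !ltr_norml => /andP[? ?] /andP[? ?] /andP[? ?] /andP[? ?];
       split; lra.
  - move=> z [/= zM zN]; rewrite -(subrr (f z)).
    move: zM zN; rewrite !ltr_norml => /dFM ? /dFN ?.
    by is_derive_tac.
  - by [].
  - by rewrite /= normr0; split; [exact: le_lt_trans xM|exact: le_lt_trans xN].
exists (fun x => F (`|x| + 1) x); split.
  by case: (FP (`|0 : R| + 1)).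
(* The glued function changes its local piece from point to point, but within distance 1 of x it
   agrees with the single piece of bound |x| + 2. *)
move=> x; have [_ dF] := FP (`|x| + 2).
have xx : - (`|x| + 2) < x < `|x| + 2 by rewrite -ltr_norml; lra.
apply: near_eq_is_derive (dF x xx); near=> z.
have zx : `|x - z| < 1 by near: z; exact: (@nbhsx_ballx _ _ x 1).
have : `|z| <= `|x - z| + `|x|.
  by have := ler_normB x (x - z); rewrite subKr addrC.
by move=> zxx; apply: F_agree; lra.
Unshelve. all: by end_near. Qed.

(** * The model profile curve, parametrized by its slope *)

Definition radius {R : realType} (m p : R) : R := (1 + p ^+ 2) `^ (2 * m)^-1.

(** This is dz/dp along the profile curve. *)
Definition speed {R : realType} (m p : R) : R := radius m p / (m * (1 + p ^+ 2)).

Definition is_height {R : realType} (m : R) (Z : R -> R) : Prop :=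
  Z 0 = 0 /\ forall p : R, is_derive p 1 Z (speed m p).

Lemma onesqr_gt0 {R : realType} (p : R) : 0 < 1 + p ^+ 2.
Proof. by rewrite ltr_pwDl ?ltr01 ?sqr_ge0. Qed.

Lemma radius_gt0 {R : realType} (m p : R) : 0 < radius m p.
Proof. exact/powR_gt0/onesqr_gt0. Qed.

Lemma radius0 {R : realType} (m : R) : radius m 0 = 1.
Proof. by rewrite /radius expr0n addr0 powR1. Qed.

Lemma radiusN {R : realType} (m p : R) : radius m (- p) = radius m p.
Proof. by rewrite /radius sqrrN. Qed.

Lemma speed_gt0 {R : realType} (m p : R) : 0 < m -> 0 < speed m p.
Proof. by move=> m0; rewrite divr_gt0 ?radius_gt0 ?mulr_gt0 ?onesqr_gt0. Qed.

Lemma radiusE {R : realType} (m p : R) : 0 < m ->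
  radius m p = m * (1 + p ^+ 2) * speed m p.
Proof.
move=> m0; rewrite /speed mulrC divfK // mulf_neq0 ?gt_eqF //.
exact: onesqr_gt0.
Qed.

(** The chain rule d rho/dp = (dr/dz) (dz/dp) expresses that the parameter p is the slope of the
    curve. *)
Lemma is_derive_radius {R : realType} (m p : R) : 0 < m ->
  is_derive p 1 (radius m) (p * speed m p).
Proof.
move=> m0; have p0 := onesqr_gt0 p.
have dsq : is_derive p 1 (fun q : R => 1 + q ^+ 2) (2 * p).
  by is_derive_by; ring.
have dr := @is_derive_comp R (fun y => y `^ (2 * m)^-1)
  (fun q => 1 + q ^+ 2) _ _ _
  (is_derive1_powR (2 * m)^-1 p0) dsq.
apply: (is_derive_congr _ dr).
rewrite powRB; last by rewrite (gt_eqF p0) implybT.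
rewrite powRr1 ?ltW// /speed /radius; field.
by rewrite !gt_eqF.
Qed.

Lemma radius_unbounded {R : realType} (m M : R) : 0 < m ->
  exists2 q : R, 0 < q & forall p, q <= `|p| -> M < radius m p.
Proof.
(* The maximum with 1 makes K positive. At |p| = K^m the term p^2 alone already gives the radius K,
   and the summand 1 makes the inequality strict. *)
move=> m0; pose K := Num.max M 1; have K0 : 0 < K by rewrite lt_max ltr01 orbT.
exists (K `^ m) => [|p Kp]; first exact: powR_gt0.
apply: (@le_lt_trans _ _ K); first by rewrite le_max lexx.
have -> : K = ((K `^ m) ^+ 2) `^ (2 * m)^-1.
  rewrite -powR_mulrn ?powR_ge0// -!powRrM.
  have -> : m * (2%:R * (2 * m)^-1) = 1 by field; rewrite gt_eqF.
  by rewrite powRr1 // ltW.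
apply: gt0_ltr_powR; rewrite ?nnegrE ?sqr_ge0 ?invr_gt0 ?mulr_gt0 ?ltW ?onesqr_gt0 //.
apply: (@le_lt_trans _ _ (`|p| ^+ 2)); last by rewrite real_normK ?num_real// ltrDr ltr01.
by rewrite ler_sqr ?nnegrE ?powR_ge0.
Qed.

Lemma is_height_exists {R : realType} (m : R) : 0 < m -> exists Z, is_height m Z.
Proof.
move=> m0; apply: exists_antiderivative => p.
have dr q := is_derive_radius m q m0.
have m1 : m * (1 + p ^+ 2) != 0 by rewrite mulf_neq0 ?gt_eqF ?onesqr_gt0.
by apply: is_derive_continuous; rewrite /speed; apply: is_derive_mul.
Qed.

Section Height.
Context {R : realType} {m : R} {Z : R -> R} (m0 : 0 < m) (hZ : is_height m Z).

Lemma is_derive_height (p : R) : is_derive p 1 Z (speed m p).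
Proof. by case: hZ. Qed.

Lemma height_incr (p q : R) : p < q -> Z p < Z q.
Proof.
move=> pq; apply: (increasing_of_derive Z (speed m)) => // z _.
  exact: is_derive_height.
exact: speed_gt0.
Qed.

Lemma heightN (p : R) : Z (- p) = - Z p.
Proof.
have dZ := is_derive_height; have [Z0 _] := hZ.
have := @constant_of_derive R setT (fun p => Z (- p) + Z p) _ _ p 0 I I.
rewrite oppr0 Z0 addr0 => /(_ _ _)/eqP; rewrite addr_eq0 => ZN.
apply/eqP/ZN => // z _.
have dZN : is_derive z 1 (fun p => Z (- p)) (speed m (- z) * -1).
  by apply: is_derive_comp => //; exact: is_derive_opp.
is_derive_by; rewrite /speed radiusN sqrrN; ring.
Qed.

End Height.

(** * Spheres orthogonal to the model surface *)

Lemma is_derive_unique {R : realType} {f : R -> R} {x a b : R} :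
  is_derive x 1 f a -> is_derive x 1 f b -> a = b.
Proof. by move=> [_ <-] [_ <-]. Qed.

Lemma is_derive_locally_cst {R : realType} {f : R -> R} {x e p d c : R} :
  (forall q, `|x - q| < e -> f q = c) -> `|x - p| < e ->
  is_derive p 1 f d -> d = 0.
Proof.
move=> fc xp dfp; apply: (is_derive_unique dfp).
apply: (@near_eq_is_derive _ _ _ (fun=> c)).
near=> q; apply/esym/fc.
have : `|x - q| <= `|x - p| + `|p - q| by exact: ler_distD.
suff : `|p - q| < e - `|x - p| by lra.
by near: q; apply: (@nbhsx_ballx _ _ p (e - `|x - p|)); lra.
Unshelve. all: by end_near. Qed.

(* This is [D^2 - A^2], where [A = Z - rho / p] is the height at which the tangent
   line of the profile meets the axis and [D] the distance to that point. *)
Lemma tangency_increasing {R : realType} {m : R} {Z : R -> R} {p q : R} :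
  0 < m -> is_height m Z -> 0 < p -> p < q ->
  radius m p ^+ 2 - Z p ^+ 2 + 2 * Z p * radius m p * p^-1 <
  radius m q ^+ 2 - Z q ^+ 2 + 2 * Z q * radius m q * q^-1.
Proof.
move=> m0 hZ p0 pq; pose rho : R -> R := radius m; rewrite -/rho.
have dZ := is_derive_height hZ; have [Z0 _] := hZ.
have drho (z : R) : is_derive z 1 rho (z * speed m z) by exact: is_derive_radius.
(* The derivative of the compared quantity is a positive multiple of rho z * z / m - Z z, which
   vanishes at 0 and increases. *)
have ZE (z : R) : 0 < z -> Z z < rho z * z / m.
  move=> z0; rewrite -subr_gt0.
  have -> : 0 = rho 0 * 0 / m - Z 0 by rewrite Z0 mulr0 mul0r subr0.
  apply: (@increasing_of_derive R (fun x => rho x * x / m - Z x)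
    (fun x => speed m x * x ^+ 2 * (m^-1 + 1))) => // [x _|x /andP[x0 _]].
    is_derive_by; rewrite /rho radiusE //; field; rewrite gt_eqF//.
  by rewrite !(speed_gt0, mulr_gt0) ?exprn_gt0 ?addr_gt0 ?invr_gt0.
apply: (@increasing_of_derive R
  (fun x => rho x ^+ 2 - Z x ^+ 2 + 2 * Z x * rho x * x^-1)
  (fun x => 2 * rho x / x ^+ 2 * (rho x * x / m - Z x))) => //.
  move=> x /andP[px _]; have x0 : x != 0 by rewrite gt_eqF// (lt_le_trans p0).
  have dV : is_derive x 1 (fun y : R => y^-1) (- 1 / x ^+ 2).
    by apply: is_derive_inv => //; exact: is_derive_id.
  is_derive_by; rewrite /rho radiusE //; field.
  by rewrite x0 gt_eqF.
move=> x /andP[px _]; have x0 := lt_trans p0 px.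
by rewrite mulr_gt0 ?subr_gt0 ?ZE// divr_gt0 ?exprn_gt0 ?mulr_gt0 ?radius_gt0.
Qed.

(* The squared distance between the centre of a sphere, at height [a] and at
   distance [Y] from the axis, and the point of the model of slope [p] in a
   direction [w], where [s] is the inner product of [w] with the centre. *)
Definition distsq {R : realType} (m : R) (Z : R -> R) (a Y p s : R) : R :=
  (Z p - a) ^+ 2 + radius m p ^+ 2 - 2 * radius m p * s + Y ^+ 2.

(** The free boundary condition seen in the frame of the model. A direction w enters only through
    its inner product s with the centre, which takes all values in [-Y, Y]. The third clause says
    that the normal (-p, w) is orthogonal to the radius at each common point, the last one that the
    ball meets the surface. *)
Definition orthogonal_ball {R : realType} (m : R) (Z : R -> R) (a Y r : R) :
    Prop :=
  [/\ 0 <= Y, 0 < r,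
     forall p s, `|s| <= Y -> distsq m Z a Y p s = r ^+ 2 ->
       radius m p - s = p * (Z p - a)
   & exists p s, `|s| <= Y /\ distsq m Z a Y p s <= r ^+ 2].

(** The case s = Y, where w points from the axis towards the centre; among the points of slope p
    this one is nearest to the centre. *)
Definition axial_distsq {R : realType} (m : R) (Z : R -> R) (a Y p : R) : R :=
  (Z p - a) ^+ 2 + (radius m p - Y) ^+ 2.

Lemma axial_distsqE {R : realType} (m : R) (Z : R -> R) (a Y p : R) :
  axial_distsq m Z a Y p = distsq m Z a Y p Y.
Proof. by rewrite /axial_distsq /distsq; ring. Qed.

Lemma is_derive_axial_distsq {R : realType} {m : R} {Z : R -> R} (a Y p : R) :
  0 < m -> is_height m Z -> is_derive p 1 (axial_distsq m Z a Y)
    (2 * speed m p * ((Z p - a) + p * (radius m p - Y))).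
Proof.
move=> m0 [_ dZ]; have drho := is_derive_radius m p m0.
by rewrite /axial_distsq; is_derive_by; ring.
Qed.

Lemma continuous_axial_distsq {R : realType} {m : R} {Z : R -> R} (a Y : R) :
  0 < m -> is_height m Z -> continuous (axial_distsq m Z a Y).
Proof.
by move=> m0 hZ p; exact: is_derive_continuous (is_derive_axial_distsq _ _ _ m0 hZ).
Qed.

(** The sphere cannot merely touch the surface from outside. At such a contact the distance is
    minimal, so the radius is normal to the profile; by orthogonality it is also tangent, hence
    zero. *)
Lemma ball_meets_interior {R : realType} {m : R} {Z : R -> R} {a Y r : R} :
  0 < m -> is_height m Z -> orthogonal_ball m Z a Y r ->
  exists p, axial_distsq m Z a Y p < r ^+ 2.
Proof.
move=> m0 hZ [Y0 r0 orth meet]; pose rho : R -> R := radius m.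
pose Phi : R -> R := axial_distsq m Z a Y.
have dZ : forall z : R, is_derive z 1 Z (speed m z) by exact: is_derive_height.
have drho (z : R) : is_derive z 1 rho (z * speed m z) by exact: is_derive_radius.
have rho_gt0 (p : R) : 0 < rho p by exact: radius_gt0.
have PhiE (p : R) : Phi p = distsq m Z a Y p Y by exact: axial_distsqE.
have dPhi (p : R) : is_derive p 1 Phi
    (2 * speed m p * ((Z p - a) + p * (rho p - Y))).
  exact: is_derive_axial_distsq.
apply: contrapT => /forallNP noPhi.
have Phi_ge p : r ^+ 2 <= Phi p by rewrite leNgt; apply/negP/noPhi.
have [p [s [sY ps]]] := meet.
have PhiEp : Phi p = r ^+ 2.
  apply/eqP; rewrite eq_le Phi_ge andbT (le_trans _ ps)// PhiE /distsq -/rho.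
  have s_le := le_trans (ler_norm s) sY; have rho_ge0 := ltW (rho_gt0 p).
  by rewrite lerD2r lerD2l lerN2 ler_wpM2l // mulr_ge0.
have pE : rho p - Y = p * (Z p - a).
  by apply: orth; rewrite ?ger0_norm// -PhiE.
have dPhi0 : is_derive p 1 Phi 0.
  apply: (@derive1_at_min _ Phi (p - 1) (p + 1)).
  - by lra.
  - by move=> t _; have [] := dPhi t.
  - by rewrite in_itv/=; apply/andP; split; lra.
  - by move=> t _; rewrite PhiEp.
have := is_derive_unique (dPhi p) dPhi0; rewrite pE.
have -> : 2 * speed m p * (Z p - a + p * (p * (Z p - a))) =
  2 * speed m p * (1 + p ^+ 2) * (Z p - a) by ring.
have k_gt0 : 0 < 2 * speed m p * (1 + p ^+ 2).
  by rewrite (mulr_gt0 _ (onesqr_gt0 p)) // (mulr_gt0 _ (speed_gt0 m p m0)).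
move/eqP; rewrite mulf_eq0 (gt_eqF k_gt0) /= => /eqP Za.
move: PhiEp; rewrite /Phi /axial_distsq pE Za mulr0 expr0n addr0 => /eqP.
by rewrite eq_sym sqrf_eq0 gt_eqF.
Qed.

(** The profile leaves the ball at both ends, since its distance from the axis exceeds Y + r for
    steep slopes. *)
Lemma exists_far {R : realType} (m : R) (Z : R -> R) (a : R) {Y r : R} :
  0 < m -> 0 <= Y -> 0 < r ->
  exists2 q : R, 0 < q & forall p, q <= `|p| -> r ^+ 2 < axial_distsq m Z a Y p.
Proof.
move=> m0 Y0 r0; pose rho : R -> R := radius m.
have [q q0 qP] := radius_unbounded m (Y + r) m0; exists q => // p /qP; rewrite -/rho => rp.
apply: (@lt_le_trans _ _ ((rho p - Y) ^+ 2)).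
  have [r_ge0 rY_ge0 rY] : [/\ 0 <= r, 0 <= rho p - Y & r < rho p - Y].
    by split; lra.
  by rewrite ltr_pXn2r.
by rewrite lerDr sqr_ge0.
Qed.

Lemma center_on_axis {R : realType} {m : R} {Z : R -> R} {a Y r : R} :
  0 < m -> is_height m Z -> orthogonal_ball m Z a Y r -> Y = 0.
Proof.
move=> m0 hZ cfg; have [Y0 r0 orth _] := cfg; pose rho : R -> R := radius m.
pose Phi : R -> R := axial_distsq m Z a Y.
have dZ : forall z : R, is_derive z 1 Z (speed m z) by exact: is_derive_height.
have drho (z : R) : is_derive z 1 rho (z * speed m z) by exact: is_derive_radius.
have rho_gt0 (p : R) : 0 < rho p by exact: radius_gt0.
have PhiE (p : R) : Phi p = distsq m Z a Y p Y by exact: axial_distsqE.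
have [p pr] := ball_meets_interior m0 hZ cfg.
apply: contrapT => /eqP Yn0; have {Yn0} Y_gt0 : 0 < Y by rewrite lt0r Yn0.
(* [H p] is the value of s for which the point of slope p lies on the sphere; it belongs to an
   actual point when |H p| <= Y. *)
pose H (p : R) : R := (distsq m Z a Y p 0 - r ^+ 2) * (2 * rho p)^-1.
have HE y : distsq m Z a Y y 0 - r ^+ 2 = 2 * rho y * H y.
  by rewrite /H; field; rewrite gt_eqF.
have PhiH y : Phi y - r ^+ 2 = 2 * rho y * (H y - Y).
  rewrite mulrBr -HE PhiE /distsq -/rho; ring.
have H_cont : continuous H.
  move=> y; have y0 : 2 * rho y != 0 by rewrite gt_eqF// mulr_gt0.
  by apply: is_derive_continuous; rewrite /H /distsq -/rho; apply: is_derive_mul.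
have Hp : H p < Y.
  by move: pr; rewrite -subr_lt0 PhiH pmulr_rlt0 ?subr_lt0 ?mulr_gt0.
have [q q0 far] := exists_far m Z a m0 Y0 r0.
have [t [pt qt]] : exists t, p <= t /\ q <= `|t|.
  exists (`|p| + q); split; first by rewrite (le_trans (ler_norm p))// lerDl ltW.
  by rewrite ger0_norm ?lerDr ?normr_ge0// addr_ge0 // ltW.
have Ht : Y < H t.
  by have := far t qt; rewrite -subr_gt0 PhiH pmulr_rgt0 ?subr_gt0 ?mulr_gt0.
(* A value of [H] strictly between 0 and Y keeps |H| < Y on a whole neighbourhood of x, so the
   sphere meets the surface at every slope near x. *)
pose v : R := (Num.max 0 (H p) + Y) / 2.
have [v0 vY Hpv] : [/\ 0 < v, v < Y & H p <= v].
  by rewrite /v; case: (lerP 0 (H p)) => ?; split; lra.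
have [x _ Hx] : exists2 x, p <= x <= t & H x = v.
  by apply: continuous_IVT => //; apply/orP; left; apply/andP; split; lra.
have [e /= e0 eP] : exists2 e : R, 0 < e & forall y, `|x - y| < e -> `|H y| < Y.
  have : nbhs x [set y | `|H y| < Y].
    have /cvgrPdist_lt/(_ (Y - v)) := H_cont x.
    rewrite subr_gt0 => /(_ vY); apply: filterS => y /=.
    by rewrite Hx !ltr_norml => /andP[? ?]; apply/andP; split; lra.
  by rewrite -nbhs_ballE => -[e /= e0 eP]; exists e.
(* [K] results from eliminating s between the sphere equation and the orthogonality equation. *)
pose K (p : R) : R :=
  (Z p - a) ^+ 2 - rho p ^+ 2 + 2 * p * rho p * (Z p - a) + Y ^+ 2 - r ^+ 2.
have dK (y : R) : is_derive y 1 K (2 * (speed m y * (1 + y ^+ 2) + rho y) * (Z y - a)).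
  by rewrite /K; is_derive_by; ring.
have K0 y : `|x - y| < e -> K y = 0.
  move=> /eP/ltW HyY; have Hd : distsq m Z a Y y (H y) = r ^+ 2.
    have := HE y; rewrite /distsq -/rho => HEy.
    by apply/eqP; rewrite -subr_eq0 -HEy; apply/eqP; ring.
  have := orth _ _ HyY Hd; have := HE y; rewrite /K /distsq -/rho => HEy yE.
  rewrite (_ : 2 * y * rho y * (Z y - a) = 2 * rho y * (y * (Z y - a))); last by ring.
  by rewrite -yE; lra.
(* The derivative of [K] is a positive multiple of Z - a, so Z would be constant near x, against its
   strict monotonicity. *)
have Za y : `|x - y| < e -> Z y = a.
  move=> xy; have /eqP := is_derive_locally_cst K0 xy (dK y).
  rewrite mulf_eq0 gt_eqF /= ?subr_eq0 => [/eqP//|].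
  by rewrite mulr_gt0 // addr_gt0 // (mulr_gt0 _ (onesqr_gt0 y)) ?speed_gt0.
have xe : x < x + e / 2 by lra.
have := height_incr m0 hZ _ _ xe; rewrite !Za ?ltxx ?subrr ?normr0 //.
by rewrite opprD addrA subrr sub0r normrN gtr0_norm; lra.
Qed.

Lemma center_origin {R : realType} {m : R} {Z : R -> R} {a Y r : R} :
  0 < m -> is_height m Z -> orthogonal_ball m Z a Y r ->
  a = 0 /\
  exists p : R, [/\ 0 < p, p * Z p = radius m p &
    Z p ^+ 2 + radius m p ^+ 2 = r ^+ 2].
Proof.
move=> m0 hZ cfg; have [Y0 r0 orth _] := cfg; pose rho : R -> R := radius m.
pose Phi : R -> R := axial_distsq m Z a Y.
have dZ : forall z : R, is_derive z 1 Z (speed m z) by exact: is_derive_height.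
have drho (z : R) : is_derive z 1 rho (z * speed m z) by exact: is_derive_radius.
have rho_gt0 (p : R) : 0 < rho p by exact: radius_gt0.
have PhiE (p : R) : Phi p = distsq m Z a Y p Y by exact: axial_distsqE.
have Phi_cont : continuous Phi by exact: continuous_axial_distsq.
have [p pr] := ball_meets_interior m0 hZ cfg.
have YE := center_on_axis m0 hZ cfg.
have [q q0 far] := exists_far m Z a m0 Y0 r0.
have norm_pq : q <= `|(`|p| + q)|.
  by rewrite ger0_norm ?lerDr ?normr_ge0// addr_ge0 // ltW.
have [p1 /andP[_ p1p] p1E] : exists2 x, - (`|p| + q) <= x <= p & Phi x = r ^+ 2.
  apply: continuous_IVT => //; first by have := ler_norm (- p); rewrite normrN; lra.
  by apply/orP; right; rewrite !ltW // far // normrN.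
have [p2 /andP[pp2 _] p2E] : exists2 x, p <= x <= `|p| + q & Phi x = r ^+ 2.
  apply: continuous_IVT => //; first by have := ler_norm p; lra.
  by apply/orP; left; rewrite !ltW // far.
have p12 : p1 < p2.
  rewrite lt_neqAle (le_trans p1p pp2) andbT; apply/eqP => p12.
  have pE : p = p1 by apply/eqP; rewrite eq_le p1p {1}p12 pp2.
  by have : Phi p < r ^+ 2 := pr; rewrite pE p1E ltxx.
(* [g] vanishes at both crossings and has derivative a - Z, so Z - a must change sign between them.
   With p (Z - a) = rho > 0 at the crossings, this gives p1 < 0 < p2. *)
pose g (p : R) : R := rho p - p * (Z p - a).
have dg (y : R) : is_derive y 1 g (a - Z y) by rewrite /g; is_derive_by; ring.
have gE y : Phi y = r ^+ 2 -> y * (Z y - a) = rho y.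
  by rewrite PhiE => /orth <-; rewrite YE ?subr0 ?normr0.
have g1 := gE _ p1E; have g2 := gE _ p2E.
have Z_incr := height_incr m0 hZ.
have Z1 : Z p1 < a.
  rewrite ltNge le_eqVlt; apply/negP => /orP[/eqP aZ|aZ].
    by have := rho_gt0 p1; rewrite -g1 -aZ subrr mulr0 ltxx.
  have : - g p1 < - g p2.
    apply: (@increasing_of_derive R (fun y => - g y) (fun y => Z y - a)) => //.
      by move=> z _; is_derive_by; ring.
    by move=> z /andP[/Z_incr ? _]; rewrite subr_gt0 (lt_trans aZ).
  by rewrite /g g1 g2 !subrr ltxx.
have Z2 : a < Z p2.
  rewrite ltNge le_eqVlt; apply/negP => /orP[/eqP aZ|aZ].
    by have := rho_gt0 p2; rewrite -g2 -aZ subrr mulr0 ltxx.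
  have : g p1 < g p2.
    apply: (@increasing_of_derive R g (fun y => a - Z y)) => //.
    by move=> z /andP[_ /Z_incr ?]; rewrite subr_gt0 (lt_trans _ aZ).
  by rewrite /g g1 g2 !subrr ltxx.
have p1_lt0 : p1 < 0 by have := rho_gt0 p1; rewrite -g1 nmulr_lgt0 // subr_lt0.
have p2_gt0 : 0 < p2 by have := rho_gt0 p2; rewrite -g2 pmulr_lgt0 // subr_gt0.
(* At a crossing the tangent line of the profile passes through the centre, so the quantity D^2 -
   A^2 of [tangency_increasing] equals r^2 - a^2. *)
pose E (p : R) : R := rho p ^+ 2 - Z p ^+ 2 + 2 * Z p * rho p * p^-1.
have EE y : y != 0 -> Phi y = r ^+ 2 -> E y = r ^+ 2 - a ^+ 2.
  move=> y0 yE; rewrite -yE /E /Phi /axial_distsq YE -/rho -(gE _ yE); field.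
  exact: y0.
have EN : E (- p1) = E p1.
  rewrite /E (heightN hZ) /rho radiusN invrN; ring.
have p1E2 : - p1 = p2.
  have p1_neq0 : p1 != 0 by rewrite lt_eqF.
  have p2_neq0 : p2 != 0 by rewrite gt_eqF.
  have : E (- p1) = E p2 by rewrite EN (EE _ p1_neq0 p1E) (EE _ p2_neq0 p2E).
  have [lt12|lt21|//] := ltgtP (- p1) p2.
  - have p1N_gt0 : 0 < - p1 by rewrite oppr_gt0.
    have : E (- p1) < E p2 := tangency_increasing m0 hZ p1N_gt0 lt12.
    by move=> + EE'; rewrite EE' ltxx.
  - have : E p2 < E (- p1) := tangency_increasing m0 hZ p2_gt0 lt21.
    by move=> + EE'; rewrite EE' ltxx.
have a0 : a = 0.
  (* The orthogonality equations at the slopes p2 and -p2 read p2 (Z p2 - a) = rho p2 and p2 (Z p2 +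
     a) = rho p2. *)
  have /eqP : p2 * a = 0.
    have p1E' : p1 = - p2 by rewrite -p1E2 opprK.
    move: g1; rewrite p1E' (heightN hZ) /rho radiusN; move: g2; rewrite /rho => <-.
    by lra.
  by rewrite mulf_eq0 gt_eqF //= => /eqP.
split=> //; exists p2; split => //; first by move: g2; rewrite a0 subr0.
by rewrite -p2E /Phi /axial_distsq YE a0 !subr0.
Qed.

(** * Solutions of the profile equation *)

(** This identifies every solution as a piece of the model curve: both relations hold at z = 0, and
    the equation makes the compared quantities constant on the interval. *)
Lemma profile_solution_slope {R : realType} {n : nat} {Z : R -> R} {I : set R}
    {r : R -> R} : (2 <= n)%N -> is_height (n%:R - 1) Z ->
  profile_solution n I r -> forall z, I z ->
  Z (r^`()%classic z) = z /\ radius (n%:R - 1) (r^`()%classic z) = r z.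
Proof.
move=> n2 [Z0 dZ] [openI itvI I0 [r0 dr0] eqI].
set m : R := n%:R - 1 in dZ *.
have m0 : 0 < m by rewrite subr_gt0 ltr1n.
set p : R -> R := r^`()%classic in dr0 *.
have drho : forall q : R, is_derive q 1 (radius m) (q * speed m q).
  by move=> q; exact: is_derive_radius.
have dr z : I z -> is_derive z 1 r (p z).
  move=> /eqI[drz _ _]; apply: DeriveDef; first exact: drz.
  by rewrite /p derive1E.
have dp z : I z -> is_derive z 1 p (r^`(2)%classic z).
  move=> /eqI[_ dpz _]; apply: DeriveDef; first exact: dpz.
  by rewrite derive1nS derive1n1 derive1E.
have ode z : I z -> r^`(2)%classic z * r z = m * (1 + p z ^+ 2).
  by move=> /eqI[_ _ /eqP]; rewrite subr_eq0 => /eqP.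
(* At a zero of r the equation would read 0 = m (1 + p^2). *)
have r_neq0 z : I z -> r z != 0.
  move=> /ode odez; apply/eqP => rz0; move: odez; rewrite rz0 mulr0 => /esym/eqP.
  by rewrite mulf_eq0 !gt_eqF ?onesqr_gt0.
have d2E z : I z -> r^`(2)%classic z = m * (1 + p z ^+ 2) / r z.
  by move=> Iz; rewrite -(ode z Iz) mulfK ?r_neq0.
have ratio z : I z -> radius m (p z) / r z = 1.
  move=> Iz; have -> : 1 = radius m (p 0) / r 0 by rewrite dr0 radius0 r0 divr1.
  apply: (@constant_of_derive R I (fun x => radius m (p x) / r x)) => // x Ix.
  have drp := is_derive_comp (drho (p x)) (dp x Ix).
  have drV := is_derive_inv (r_neq0 x Ix) (dr x Ix).
  is_derive_by; rewrite d2E // radiusE //; field.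
  exact: r_neq0.
move=> z Iz; have rhoE x : I x -> radius m (p x) = r x.
  by move=> Ix; rewrite -[RHS]mul1r -(ratio x Ix) divfK ?r_neq0.
split; last exact: rhoE.
apply/eqP; rewrite -subr_eq0; apply/eqP.
have -> : 0 = Z (p 0) - 0 by rewrite dr0 Z0 subr0.
apply: (@constant_of_derive R I (fun x => Z (p x) - x)) => // x Ix.
have dZp := is_derive_comp (dZ (p x)) (dp x Ix).
is_derive_by; rewrite d2E // -rhoE // radiusE //; field.
by rewrite !gt_eqF ?onesqr_gt0 ?(speed_gt0 m _ m0).
Qed.

(** Outside the range of [Z] the value is the default 0; there the values of a profile are
    irrelevant. *)
Definition inverse {R : realType} (Z : R -> R) (z : R) : R := xget 0 [set p | Z p = z].

Lemma inverseK {R : realType} {m : R} {Z : R -> R} : 0 < m -> is_height m Z ->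
  cancel Z (inverse Z).
Proof.
move=> m0 hZ p; rewrite /inverse; case: xgetP => [q _ /= ZE|/(_ p)/=]; last by case.
have incr := height_incr m0 hZ.
by have [/incr|/incr|//] := ltgtP q p; rewrite ZE ltxx.
Qed.

Lemma continuous_height {R : realType} {m : R} {Z : R -> R} : is_height m Z ->
  continuous Z.
Proof. by move=> [_ dZ] p; exact: is_derive_continuous (dZ p). Qed.

Lemma is_derive_inverse_height {R : realType} {m : R} {Z : R -> R} (p : R) :
  0 < m -> is_height m Z -> is_derive (Z p) 1 (inverse Z) (speed m p)^-1.
Proof.
move=> m0 hZ; apply: is_derive_inverse.
- by near=> q; exact: inverseK m0 hZ q.
- by near=> q; exact: continuous_height hZ q.
- exact: is_derive_height.
- by rewrite gt_eqF ?speed_gt0.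
Unshelve. all: by end_near. Qed.

Lemma open_range_height {R : realType} {m : R} {Z : R -> R} :
  0 < m -> is_height m Z -> open (range Z).
Proof.
move=> m0 hZ; rewrite openE => _ [p _ <-]; rewrite /interior.
have [||_] := @near_can_continuousAcan_sym R Z (inverse Z) p.
- by near=> q; exact: inverseK m0 hZ q.
- by near=> q; exact: continuous_height hZ q.
by apply: filterS => z <-; exists (inverse Z z).
Unshelve. all: by end_near. Qed.

Lemma interval_range_height {R : realType} {m : R} {Z : R -> R} :
  0 < m -> is_height m Z -> is_interval (range Z).
Proof.
move=> m0 hZ _ _ [p _ <-] [q _ <-] z /andP[pz zq].
have [qp|pq] := ltP q p.
  by have := height_incr m0 hZ _ _ qp; rewrite ltNge (le_trans pz zq).
have [||c _ <-] := @continuous_IVT R Z p q z pq.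
- exact: continuous_height hZ.
- by rewrite pz zq.
- by exists c.
Qed.

(** At height Z p the first derivative is p and the second is 1 / speed p, so the equation becomes
    [radiusE]. *)
Lemma profile_solution_height {R : realType} {n : nat} {Z : R -> R} :
  (2 <= n)%N -> is_height (n%:R - 1) Z ->
  profile_solution n (range Z) (fun z => radius (n%:R - 1) (inverse Z z)).
Proof.
move=> n2 hZ; set m : R := n%:R - 1 in hZ *.
have m0 : 0 < m by rewrite subr_gt0 ltr1n.
have [Z0 dZ] := hZ; have WK := inverseK m0 hZ.
set W := inverse Z in WK *; set r := fun z => radius m (W z).
have dW p : is_derive (Z p) 1 W (speed m p)^-1 by exact: is_derive_inverse_height.
have dr p : is_derive (Z p) 1 r p.
  have dWp := dW p; have drho := is_derive_radius m (W (Z p)) m0.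
  apply: (is_derive_congr _ (is_derive_comp drho dWp)).
  by rewrite WK mulfK // gt_eqF ?speed_gt0.
have dr1 z : range Z z -> r^`()%classic z = W z.
  by move=> [p _ <-]; rewrite WK derive1E; have [_ ->] := dr p.
have I0 : range Z 0 by exists 0.
split.
- exact: (open_range_height m0 hZ).
- exact: (interval_range_height m0 hZ).
- exact: I0.
- by rewrite dr1 // /r -Z0 WK radius0.
move=> _ [p _ <-].
(* The formula r' = W is known on the range of Z only; that range is open, so it may be
   differentiated. *)
have dr2 : is_derive (Z p) 1 (r^`()%classic) (speed m p)^-1.
  apply: near_eq_is_derive (dW p).
  have : nbhs (Z p) (range Z).
    by apply: open_nbhs_nbhs; split; [exact: (open_range_height m0 hZ)|exists p].
  by apply: filterS => z /dr1.
split; [by have [] := dr p|by have [] := dr2|].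
rewrite derive1nS derive1n1 derive1E; have [_ ->] := dr2.
have -> : r^`()%classic (Z p) = p by rewrite dr1 ?WK; [|exists p].
rewrite /r WK radiusE // -/m; field.
by rewrite gt_eqF ?speed_gt0.
Qed.

(** An extended real, so that bounded and unbounded heights are treated alike. *)
Definition half_length {R : realType} (Z : R -> R) : \bar R :=
  ereal_sup (range (EFin \o Z)).

(** The range is an interval, symmetric because Z is odd, and its supremum is not attained because Z
    is strictly increasing. *)
Lemma sym_itv_half_length {R : realType} {m : R} {Z : R -> R} :
  0 < m -> is_height m Z -> sym_itv (half_length Z) = range Z.
Proof.
move=> m0 hZ.
have lt_half q : ((Z q)%:E < half_length Z)%E.
  apply: (@lt_le_trans _ _ (Z (q + 1))%:E).
    by rewrite lte_fin; apply: (height_incr m0 hZ); rewrite ltrDl.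
  by apply: ereal_sup_ubound; exists (q + 1).
apply/seteqP; split=> [z [/=]|_ [p _ <-]].
  rewrite lteNl -EFinN => /ereal_sup_gt[_ [q _ <-]] /=; rewrite lte_fin => zq.
  move=> /ereal_sup_gt[_ [q' _ <-]] /=; rewrite lte_fin => zq'.
  apply: (interval_range_height m0 hZ (Z (- q)) (Z q')); [by exists (- q)|by exists q'|].
  by rewrite (heightN hZ) (ltW zq') andbT lerNl ltW.
by split; rewrite ?lt_half // lteNl -EFinN -(heightN hZ) lt_half.
Qed.

Lemma maximal_profile_exists {R : realType} {n : nat} {Z : R -> R} :
  (2 <= n)%N -> is_height (n%:R - 1) Z ->
  maximal_profile n (half_length Z) (fun z => radius (n%:R - 1) (inverse Z z)).
Proof.
move=> n2 hZ; have m0 : 0 < n%:R - 1 :> R by rewrite subr_gt0 ltr1n.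
rewrite /maximal_profile (sym_itv_half_length m0 hZ); split.
  exact: profile_solution_height.
move=> J s sJ _ _ z Jz; have [<- _] := profile_solution_slope n2 hZ sJ _ Jz.
by exists (s^`()%classic z).
Qed.

(** The given solution is a restriction of the model solution; taking the latter as competitor in
    the maximality condition gives equality of the intervals. *)
Lemma maximal_profile_unique {R : realType} {n : nat} {Z : R -> R} {T : \bar R}
    {r : R -> R} : (2 <= n)%N -> is_height (n%:R - 1) Z -> maximal_profile n T r ->
  sym_itv T = range Z /\ forall p, r (Z p) = radius (n%:R - 1) p.
Proof.
move=> n2 hZ [sol maxT]; have m0 : 0 < n%:R - 1 :> R by rewrite subr_gt0 ltr1n.
have slope := profile_solution_slope n2 hZ sol.
have TZ : sym_itv T `<=` range Z.
  by move=> z /slope[<- _]; exists (r^`()%classic z).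
have ZT : range Z `<=` sym_itv T.
  apply: (maxT _ _ (profile_solution_height n2 hZ) TZ) => z /slope[Zr rE].
  by rewrite -{1}Zr (inverseK m0 hZ).
split; first by apply/seteqP.
move=> p; have /slope[Zr <-] : sym_itv T (Z p) by apply: ZT; exists p.
by congr radius; rewrite -(inverseK m0 hZ (r^`()%classic _)) Zr (inverseK m0 hZ).
Qed.

(** * The Euclidean inner product and linear isometries *)

Lemma dot_mulmxtr {R : realType} {k : nat} (u v : 'rV[R]_k) :
  dot u v = (u *m v^T) 0 0.
Proof. by rewrite mxE; apply: eq_bigr => i _; rewrite mxE. Qed.

Section Dot.
Context {R : realType} {k : nat}.
Implicit Types u v w : 'rV[R]_k.

Lemma dotC u v : dot u v = dot v u.
Proof. by apply: eq_bigr => i _; rewrite mulrC. Qed.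

Lemma dotDl u v w : dot (u + v) w = dot u w + dot v w.
Proof. by rewrite /dot -big_split; apply: eq_bigr => i _; rewrite mxE mulrDl. Qed.

Lemma dotZl (a : R) u v : dot (a *: u) v = a * dot u v.
Proof. by rewrite /dot mulr_sumr; apply: eq_bigr => i _; rewrite mxE mulrA. Qed.

Lemma dotDr u v w : dot w (u + v) = dot w u + dot w v.
Proof. by rewrite dotC dotDl !(dotC w). Qed.

Lemma dotZr (a : R) u v : dot u (a *: v) = a * dot u v.
Proof. by rewrite dotC dotZl dotC. Qed.

Lemma dotNl u v : dot (- u) v = - dot u v.
Proof. by rewrite -scaleN1r dotZl mulN1r. Qed.

Lemma dotNr u v : dot u (- v) = - dot u v.
Proof. by rewrite dotC dotNl dotC. Qed.

Definition dotE := (dotDl, dotDr, dotNl, dotNr, dotZl, dotZr).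

Lemma dot_ge0 u : 0 <= dot u u.
Proof. by apply: sumr_ge0 => i _; rewrite -expr2 sqr_ge0. Qed.

Lemma dot_eq0 u : dot u u = 0 -> u = 0.
Proof.
move=> u0; apply/rowP => i; rewrite mxE; apply/eqP.
have /psumr_eq0P/(_ u0 i isT)/eqP : forall j, true -> 0 <= u 0 j * u 0 j.
  by move=> j _; rewrite -expr2 sqr_ge0.
by rewrite mulf_eq0 orbb.
Qed.

Lemma enorm_ge0 u : 0 <= enorm u.
Proof. exact: sqrtr_ge0. Qed.

Lemma enorm_sqr u : enorm u ^+ 2 = dot u u.
Proof. by rewrite sqr_sqrtr ?dot_ge0. Qed.

Lemma enormZ (a : R) u : 0 <= a -> enorm (a *: u) = a * enorm u.
Proof.
by move=> a0; rewrite /enorm !dotE mulrA -expr2 sqrtrM ?sqr_ge0 // sqrtr_sqr ger0_norm.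
Qed.

Lemma enorm1P u : enorm u = 1 <-> dot u u = 1.
Proof.
by rewrite -enorm_sqr; split=> [->|/eqP]; rewrite ?expr1n // sqrp_eq1 ?enorm_ge0 // => /eqP.
Qed.

(** Cauchy-Schwarz, from the squared length of the component of v orthogonal to u. *)
Lemma unit_dot_le u v : enorm u = 1 -> `|dot u v| <= enorm v.
Proof.
move=> /enorm1P u1; rewrite -(ler_pXn2r (_ : (0 < 2)%N)) ?nnegrE ?enorm_ge0 //.
rewrite enorm_sqr real_normK ?num_real // -subr_ge0.
have := dot_ge0 (v - dot u v *: u); rewrite !dotE u1 (dotC v u).
by congr (0 <= _); ring.
Qed.

Lemma dot_mulmx {l : nat} u (v : 'rV[R]_l) (A : 'M[R]_(k, l)) :
  dot (u *m A) v = dot u (v *m A^T).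
Proof.
by rewrite !dot_mulmxtr trmx_mul trmxK mulmxA.
Qed.

(** The column u^T has rank at most 1 < k, so its left kernel contains a nonzero row, which is then
    normalized. *)
Lemma exists_unit_orthogonal u : (2 <= k)%N -> exists e, enorm e = 1 /\ dot e u = 0.
Proof.
move=> k2; have K0 : kermx u^T != 0.
  rewrite -mxrank_eq0 mxrank_ker subn_eq0 -ltnNge.
  by apply: leq_ltn_trans k2; exact: rank_leq_col.
pose e := nz_row (kermx u^T); have e0 : e != 0 by rewrite nz_row_eq0.
have eu : dot e u = 0.
  have /sub_kermxP eK : (e <= kermx u^T)%MS by exact: nz_row_sub.
  by rewrite dot_mulmxtr eK mxE.
have e1 : enorm e != 0.
  by apply: contra_neq e0 => e1; apply: dot_eq0; rewrite -enorm_sqr e1 expr0n.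
exists ((enorm e)^-1 *: e); split; last by rewrite dotZl eu mulr0.
by rewrite enormZ ?invr_ge0 ?enorm_ge0 // mulVf.
Qed.

Lemma exists_unit_dot u (s : R) : (2 <= k)%N -> `|s| <= enorm u ->
  exists w, enorm w = 1 /\ dot w u = s.
Proof.
move=> k2 su; have [e [/enorm1P e1 eu]] := exists_unit_orthogonal u k2.
(* The vector a u has inner product s with u and squared length a s; a unit vector e orthogonal to u
   supplies the missing length. If u = 0 then s = 0, and division by zero gives a = 0. *)
pose a := s / dot u u.
have aE : a * dot u u = s.
  rewrite /a; have [u0|u0] := eqVneq (dot u u) 0; last by rewrite divfK.
  by move: su; rewrite u0 mulr0 /enorm u0 sqrtr0 normr_le0 => /eqP.
have as_le1 : a * s <= 1.
  rewrite /a; have [->|u0] := eqVneq (dot u u) 0; first by rewrite invr0 mulr0 mul0r.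
  rewrite mulrAC ler_pdivrMr ?mul1r; last by rewrite lt0r u0 dot_ge0.
  rewrite -expr2 -enorm_sqr -(real_normK (num_real s)).
  by rewrite ler_pXn2r // ?nnegrE ?enorm_ge0.
exists (a *: u + Num.sqrt (1 - a * s) *: e); split; last first.
  by rewrite !dotE eu mulr0 addr0.
apply/enorm1P; rewrite !dotE (dotC u e) eu e1 aE !mulr0 addr0 add0r mulr1 -expr2.
by rewrite sqr_sqrtr ?subr_ge0 // addrC subrK.
Qed.

End Dot.

Section Isometry.
Context {R : realType} {k : nat} {M : 'M[R]_k} (MM : M *m M^T = 1%:M).

Lemma isometry_trmx : M^T *m M = 1%:M.
Proof. exact: mulmx1C. Qed.

Lemma dot_isometry (u v : 'rV[R]_k) : dot (u *m M) (v *m M) = dot u v.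
Proof. by rewrite dot_mulmx -mulmxA MM mulmx1. Qed.

Lemma enorm_isometry (u : 'rV[R]_k) : enorm (u *m M) = enorm u.
Proof. by rewrite /enorm dot_isometry. Qed.

End Isometry.

(** Polarization turns preservation of the norm into preservation of the inner product, which is
    then read off on the standard basis. *)
Lemma linear_isometry_mx {R : realType} {k : nat}
    (L : {linear 'rV[R]_k -> 'rV[R]_k}) : linear_isometry L ->
  exists M : 'M[R]_k, M *m M^T = 1%:M /\ forall u, L u = u *m M.
Proof.
move=> isoL; exists (lin1_mx L); set M := lin1_mx L.
have LM u : L u = u *m M by rewrite mul_rV_lin1.
split=> //; have dotL u v : dot (L u) (L v) = dot u v.
  have sq x : dot (L x) (L x) = dot x x by rewrite -!enorm_sqr isoL.
  have := sq (u + v); rewrite linearD !dotE !sq (dotC (L v)) (dotC v).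
  by lra.
apply/matrixP => i j.
have := dotL (delta_mx 0 i) (delta_mx 0 j).
rewrite !LM dot_mulmx -mulmxA dot_mulmxtr [in RHS]dot_mulmxtr !trmx_mul !trmxK.
rewrite -[X in _ = (X *m _) 0 0 -> _]mulmx1 trmx_delta mulmxA -!rowE -!colE.
by rewrite !mxE.
Qed.

(** * Tangent and normal vectors of spheres and of similar images *)

Lemma is_derive_row {R : realType} {k : nat} (g : R -> 'rV[R]_k.+1) (t : R)
    (v : 'rV[R]_k.+1) :
  is_derive t 1 g v <-> forall j, is_derive t 1 (fun x => g x 0 j) (v 0 j).
Proof.
split=> [[dg gE] j|dg].
  apply: DeriveDef; first by have /derivable_mxP := dg; apply.
  by rewrite -gE derive_mx // mxE.
have dg' : derivable g t 1.
  by apply/derivable_mxP => i j; rewrite ord1; have [] := dg j.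
apply: DeriveDef => //; apply/rowP => j.
by rewrite derive_mx // mxE; have [_ ->] := dg j.
Qed.

Lemma is_derive_bigsum {R : realType} {k : nat} (f : 'I_k -> R -> R) (t : R)
    (d : 'I_k -> R) : (forall i, is_derive t 1 (f i) (d i)) ->
  is_derive t 1 (fun x => \sum_(i < k) f i x) (\sum_(i < k) d i).
Proof.
move=> fd; have -> : (fun x => \sum_(i < k) f i x) = \sum_(i < k) f i.
  by apply/funext => x; rewrite fct_sumE.
exact: is_derive_sum.
Qed.

Lemma is_derive_dot {R : realType} {k : nat} {g h : R -> 'rV[R]_k} {t : R}
    {v w : 'rV[R]_k} :
  (forall j, is_derive t 1 (fun x => g x 0 j) (v 0 j)) ->
  (forall j, is_derive t 1 (fun x => h x 0 j) (w 0 j)) ->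
  is_derive t 1 (fun x => dot (g x) (h x)) (dot v (h t) + dot (g t) w).
Proof.
move=> dg dh; rewrite /dot -big_split; apply: is_derive_bigsum => i.
exact: is_derive_mul.
Qed.

Lemma normal_sphere {R : realType} {k : nat} (p : 'rV[R]_k.+1) :
  normal (@unit_sphere R k.+1) p p.
Proof.
move=> v [g [g0 gS dg]]; have /is_derive_row dgj := dg.
have := is_derive_dot dgj dgj; rewrite g0 => dgg.
have dgg0 : is_derive (0 : R) 1 (fun x => dot (g x) (g x)) 0.
  apply: (@near_eq_is_derive _ _ _ (fun=> 1 : R)).
  by apply: filterS gS => t /enorm1P.
have := is_derive_unique dgg dgg0; rewrite (dotC v).
by lra.
Qed.

(* The curve is the rational parametrization of the great circle through [p]
   in the direction [v]. *)
Lemma tangent_sphere {R : realType} {k : nat} (p v : 'rV[R]_k.+1) :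
  enorm p = 1 -> dot p v = 0 -> tangent (@unit_sphere R k.+1) p v.
Proof.
(* The factor 1/4 makes (1 - c)^2 + t^2 |v|^2 equal to (1 + c)^2. *)
move=> /enorm1P p1 pv; pose c (t : R) := t ^+ 2 * dot v v / 4.
have c_gt0 t : 0 < 1 + c t.
  by rewrite ltr_pwDl // divr_ge0 // mulr_ge0 ?sqr_ge0 ?dot_ge0.
exists (fun t => ((1 - c t) / (1 + c t)) *: p + (t / (1 + c t)) *: v); split.
- by rewrite /c expr0n /= !mul0r subr0 addr0 divr1 scale1r scale0r addr0.
- near=> t; apply/enorm1P; rewrite !dotE (dotC v) p1 pv.
  have c1 : 1 + c t != 0 by rewrite gt_eqF.
  have vE : t ^+ 2 * dot v v = 4 * c t by rewrite /c; field.
  rewrite !mulr0 add0r addr0 mulr1 mulrA.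
  have -> : t / (1 + c t) * (t / (1 + c t)) * dot v v = 4 * c t / (1 + c t) ^+ 2.
    by rewrite -vE; field.
  by field.
apply/is_derive_row => j.
have dc : is_derive (0 : R) 1 c 0 by rewrite /c; is_derive_by; ring.
have c0 : c 0 = 0 by rewrite /c expr0n /= !mul0r.
have c1 : 1 + c 0 != 0 by rewrite gt_eqF.
have dV : is_derive (0 : R) 1 (fun t => (1 + c t)^-1) (- 0 / (1 + c 0) ^+ 2).
  by apply: is_derive_inv => //; is_derive_by; ring.
have -> : (fun t => (((1 - c t) / (1 + c t)) *: p + (t / (1 + c t)) *: v) 0 j) =
    (fun t => (1 - c t) * (1 + c t)^-1 * p 0 j + t * (1 + c t)^-1 * v 0 j).
  by apply/funext => t; rewrite !mxE.
by is_derive_by; rewrite c0; field.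
Unshelve. all: by end_near. Qed.

(** The normals of the sphere at p are the multiples of p: the component of a normal u' orthogonal
    to p is tangent to the sphere, hence orthogonal to u' and therefore zero. *)
Lemma meet_orthogonally_sphereP {R : realType} {k : nat} (S : set 'rV[R]_k.+1)
    (p : 'rV[R]_k.+1) : enorm p = 1 ->
  meet_orthogonally S (@unit_sphere R k.+1) p <->
  (forall u, normal S p u -> dot u p = 0).
Proof.
move=> p1; split=> [orth u Su|orth u u' Su Su'].
  by apply: orth => //; exact: normal_sphere.
have /enorm1P pp := p1.
have [v vE] : exists v, v = u' - dot u' p *: p by eexists.
have pv : dot p v = 0 by rewrite vE !dotE pp mulr1 dotC subrr.
have u'v := Su' v (tangent_sphere _ _ p1 pv).
have /dot_eq0/eqP : dot v v = 0 by rewrite {1}vE !dotE u'v pv mulr0 subr0.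
by rewrite vE subr_eq0 => /eqP ->; rewrite dotZr (orth u Su) mulr0.
Qed.

(** A curve in the image is pulled back to C by the inverse similarity, which multiplies its
    velocity by [c^-1] and [M^T]. *)
Lemma normal_similarity {R : realType} {k : nat} {M : 'M[R]_k.+1}
    {C : set 'rV[R]_k.+1} {c : R} (b : 'rV[R]_k.+1) {x u : 'rV[R]_k.+1} :
  M *m M^T = 1%:M -> 0 < c -> normal C x u ->
  normal [set c *: (y *m M) + b | y in C] (c *: (x *m M) + b) (u *m M).
Proof.
move=> MM c0 Cu v [g [g0 gS dg]]; have /is_derive_row dgj := dg.
have cN0 : c != 0 by rewrite gt_eqF.
have back y : c^-1 *: ((c *: (y *m M) + b - b) *m M^T) = y.
  by rewrite addrK -scalemxAl scalerA mulVf // scale1r -mulmxA MM mulmx1.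
have : tangent C x (c^-1 *: (v *m M^T)).
  exists (fun t => c^-1 *: ((g t - b) *m M^T)); split.
  - by rewrite g0 back.
  - by apply: filterS gS => t [y Cy <-]; rewrite back.
  apply/is_derive_row => j.
  have -> : (fun t => (c^-1 *: ((g t - b) *m M^T)) 0 j) =
      (fun t => c^-1 * \sum_i (g t 0 i - b 0 i) * M^T i j).
    by apply/funext => t; rewrite !mxE; congr (_ * _); apply: eq_bigr => i _; rewrite !mxE.
  have dsum : is_derive (0 : R) 1 (fun t => \sum_i (g t 0 i - b 0 i) * M^T i j)
      (\sum_i v 0 i * M^T i j).
    apply: is_derive_bigsum => i; have dgi := dgj i.
    by is_derive_by; ring.
  is_derive_by; rewrite !mxE; ring.
move=> /Cu; rewrite dotZr dot_mulmx => /eqP.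
by rewrite mulf_eq0 invr_eq0 (negbTE cN0) => /eqP.
Qed.

(** * The model catenoid as a hypersurface *)

Section AxisPoint.
Context {R : realType} {n : nat}.

Lemma axis_pointEl (z : R) (y : 'rV[R]_n) : axis_point z y 0 (@lshift 1 n 0) = z.
Proof. by apply: etrans (row_mxEl _ _ _ _) _; rewrite mxE eqxx. Qed.

Lemma axis_pointEr (z : R) (y : 'rV[R]_n) (j : 'I_n) :
  axis_point z y 0 (@rshift 1 n j) = y 0 j.
Proof. exact: row_mxEr. Qed.

Lemma axis_pointP (P : 'I_n.+1 -> Prop) :
  P (@lshift 1 n 0) -> (forall j, P (@rshift 1 n j)) -> forall j, P j.
Proof.
by move=> Pl Pr j; case: (split_ordP (j : 'I_(1 + n))) => i ->; rewrite ?ord1.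
Qed.

Lemma axis_point_split (x : 'rV[R]_n.+1) :
  x = axis_point (x 0 (@lshift 1 n 0)) (\row_j x 0 (@rshift 1 n j)).
Proof.
apply/rowP; apply: axis_pointP => [|j]; first by rewrite axis_pointEl.
by rewrite axis_pointEr mxE.
Qed.

Lemma dot_axis_point (z z' : R) (y y' : 'rV[R]_n) :
  dot (axis_point z y) (axis_point z' y') = z * z' + dot y y'.
Proof.
rewrite /dot (@big_split_ord _ _ _ 1 n) /= big_ord1 !axis_pointEl; congr (_ + _).
by apply: eq_bigr => j _; rewrite !axis_pointEr.
Qed.

Lemma axis_pointB (z z' : R) (y y' : 'rV[R]_n) :
  axis_point z y - axis_point z' y' = axis_point (z - z') (y - y').
Proof.
apply/rowP; apply: axis_pointP => [|j]; rewrite mxE [X in _ + X]mxE.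
  by rewrite !axis_pointEl.
by rewrite !axis_pointEr !mxE.
Qed.

End AxisPoint.

(** With the slope as parameter, p runs through all real numbers and no interval of definition is
    involved. *)
Definition catenoid_surface {R : realType} (n : nat) (m : R) (Z : R -> R) :
    set 'rV[R]_n.+1 :=
  [set x | exists p (w : 'rV[R]_n),
    enorm w = 1 /\ x = axis_point (Z p) (radius m p *: w)].

Lemma profile_catenoidE {R : realType} {n : nat} {Z : R -> R} {T : \bar R}
    {r : R -> R} : (2 <= n)%N -> is_height (n%:R - 1) Z -> maximal_profile n T r ->
  profile_catenoid T r = catenoid_surface n (n%:R - 1) Z.
Proof.
move=> n2 hZ maxT; have [TE rE] := maximal_profile_unique n2 hZ maxT.
apply/seteqP; split=> x.
  by move=> [z [w []]]; rewrite TE => -[p _ <-] w1 ->; exists p, w; rewrite rE.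
move=> [p [w [w1 ->]]]; exists (Z p), w; rewrite rE; split => //.
by rewrite TE; exists p.
Qed.

(** On the surface |y|^2 is the squared radius at height z. Differentiating this equation along any
    curve in the surface gives w . y' = p z' at the base point. *)
Lemma normal_catenoid_surface {R : realType} {n : nat} {m : R} {Z : R -> R} (p : R)
    (w : 'rV[R]_n) : 0 < m -> is_height m Z -> enorm w = 1 ->
  normal (catenoid_surface n m Z) (axis_point (Z p) (radius m p *: w))
    (axis_point (- p) w).
Proof.
move=> m0 hZ w1 v [g [g0 gS dg]]; have /is_derive_row dgj := dg.
pose z t := g t 0 (@lshift 1 n 0); pose y t : 'rV[R]_n := \row_j g t 0 (@rshift 1 n j).
pose vy : 'rV[R]_n := \row_j v 0 (@rshift 1 n j).
have z0 : z 0 = Z p by rewrite /z g0 axis_pointEl.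
have y0 : y 0 = radius m p *: w.
  by apply/rowP => j; rewrite mxE g0 axis_pointEr.
have dz : is_derive (0 : R) 1 z (v 0 (@lshift 1 n 0)) by exact: dgj.
have dy j : is_derive (0 : R) 1 (fun t => y t 0 j) (vy 0 j).
  have -> : (fun t => y t 0 j) = (fun t => g t 0 (@rshift 1 n j)).
    by apply/funext => t; rewrite mxE.
  by rewrite mxE; exact: dgj.
have dyy := is_derive_dot dy dy; rewrite y0 in dyy.
have dr : is_derive (0 : R) 1 (fun t => radius m (inverse Z (z t)) ^+ 2)
    (2 * radius m p * p * v 0 (@lshift 1 n 0)).
  have dWz : is_derive (z 0) 1 (inverse Z) (speed m p)^-1.
    by rewrite z0; exact: is_derive_inverse_height.
  have drho := is_derive_radius m (inverse Z (z 0)) m0.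
  have dW := is_derive_comp dWz dz.
  have drW := @is_derive_comp _ _ (fun t => inverse Z (z t)) _ _ _ drho dW.
  is_derive_by; rewrite z0 (inverseK m0 hZ); field.
  by rewrite gt_eqF ?speed_gt0.
have dyy' : is_derive (0 : R) 1 (fun t => dot (y t) (y t))
    (2 * radius m p * p * v 0 (@lshift 1 n 0)).
  apply: near_eq_is_derive dr; apply: filterS gS => t [q [x [/enorm1P x1 gt]]].
  have -> : z t = Z q by rewrite /z gt axis_pointEl.
  have -> : y t = radius m q *: x by apply/rowP => j; rewrite mxE gt axis_pointEr.
  by rewrite (inverseK m0 hZ) !dotE x1 mulr1 expr2.
have := is_derive_unique dyy dyy'; rewrite dotZr dotZl (dotC vy) => eqv.
rewrite (axis_point_split v) dot_axis_point -/vy.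
have /eqP : 2 * radius m p * (dot w vy - p * v 0 (@lshift 1 n 0)) = 0 by lra.
rewrite mulf_eq0 gt_eqF ?mulr_gt0 ?radius_gt0 //= => /eqP.
by lra.
Qed.

(** * Normal form of a free boundary catenoid *)

(** Pulled back to the frame of the model, the unit ball becomes an [orthogonal_ball] of radius 1/c,
    whose centre must be the origin; so the translation disappears, and the equations for p and c
    leave only M free. *)
Lemma free_boundary_normal_form {R : realType} {n : nat} {Z : R -> R}
    {Sigma : set 'rV[R]_n.+1} : (2 <= n)%N -> is_height (n%:R - 1) Z ->
  free_boundary_catenoid Sigma ->
  exists (c p : R) (M : 'M[R]_n.+1), [/\ 0 < c, 0 < p,
    p * Z p = radius (n%:R - 1) p,
    c ^+ 2 * (Z p ^+ 2 + radius (n%:R - 1) p ^+ 2) = 1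
  & M *m M^T = 1%:M /\ Sigma = [set x *m M | x in
      [set c *: x | x in catenoid_surface n (n%:R - 1) Z] `&` @unit_ball R n.+1]].
Proof.
move=> n2 hZ [_ [[T [r [c [L [b [maxT c0 isoL ->]]]]]] orth -> Sigma0]].
set m : R := n%:R - 1 in hZ *.
have m0 : 0 < m by rewrite subr_gt0 ltr1n.
have cN0 : c != 0 by rewrite gt_eqF.
have [M [MM LM]] := linear_isometry_mx L isoL.
have MM' : M^T *m M = 1%:M := isometry_trmx MM.
rewrite (profile_catenoidE n2 hZ maxT) -/m in orth Sigma0 *.
set C := catenoid_surface n m Z in orth Sigma0 *.
have SE : [set c *: L x + b | x in C] = [set c *: (x *m M) + b | x in C].
  by apply: eq_imagel => x _; rewrite LM.
rewrite SE in orth Sigma0 *.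
(* [q] is the preimage of the origin under the similarity, that is, the centre of the pulled back
   ball. *)
pose q : 'rV[R]_n.+1 := - (c^-1 *: (b *m M^T)).
have qE x : c *: (x *m M) + b = c *: ((x - q) *m M).
  rewrite mulmxBl scalerBr mulNmx scalerN opprK -scalemxAl scalerA mulfV //.
  by rewrite scale1r -mulmxA MM' mulmx1.
have enormE x : enorm (c *: (x *m M) + b) = c * enorm (x - q).
  by rewrite qE enormZ ?ltW // (enorm_isometry MM).
pose a := q 0 (@lshift 1 n 0); pose y : 'rV[R]_n := \row_j q 0 (@rshift 1 n j).
have qay : q = axis_point a y by exact: axis_point_split.
have distE p w : enorm w = 1 -> enorm (axis_point (Z p) (radius m p *: w) - q) ^+ 2
    = distsq m Z a (enorm y) p (dot w y).
  move=> /enorm1P w1; rewrite enorm_sqr qay axis_pointB dot_axis_point /distsq.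
  by rewrite !dotE enorm_sqr w1 (dotC y w); ring.
have cV0 : 0 < c^-1 by rewrite invr_gt0.
have cfg : orthogonal_ball m Z a (enorm y) c^-1.
  split=> [||p s sy ps|]; [exact: enorm_ge0|exact: cV0| |].
    have [w [w1 wy]] := exists_unit_dot y s n2 sy.
    set x := axis_point (Z p) (radius m p *: w).
    have xC : C x by exists p, w.
    have xq : enorm (x - q) = c^-1.
      apply/eqP; rewrite -(@eqrXn2 _ 2) ?enorm_ge0 ?(ltW cV0) //.
      by rewrite distE // wy ps.
    have X1 : enorm (c *: (x *m M) + b) = 1 by rewrite enormE xq mulfV.
    have XS : [set c *: (x *m M) + b | x in C] (c *: (x *m M) + b) by exists x.
    have /(meet_orthogonally_sphereP _ _ X1) := orth _ XS X1.
    move=> /(_ _ (normal_similarity b MM c0 (normal_catenoid_surface p w m0 hZ w1))).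
    rewrite -/x qE dotZr (dot_isometry MM) qay axis_pointB dot_axis_point.
    move/eqP; rewrite mulf_eq0 (negbTE cN0) /= !dotE wy => /eqP.
    by have /enorm1P -> := w1; lra.
  have [X [[x xC <-]]] := Sigma0.
  have [p [w [w1 xE]]] := xC.
  rewrite /unit_ball /= enormE => xq; exists p, (dot w y).
  split; first exact: unit_dot_le.
  rewrite -distE // -xE ler_pXn2r ?nnegrE ?enorm_ge0 ?(ltW cV0) //.
  by rewrite -[leRHS]mul1r ler_pdivlMr // mulrC.
have Y0 := center_on_axis m0 hZ cfg.
have [a0 [p [p0 pE pr]]] := center_origin m0 hZ cfg.
have y0 : y = 0 by apply: dot_eq0; rewrite -enorm_sqr Y0 expr0n.
have q0 : q = 0.
  rewrite qay a0 y0; apply/rowP; apply: axis_pointP => [|j].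
    by rewrite axis_pointEl mxE.
  by rewrite axis_pointEr !mxE.
have b0 x : c *: (x *m M) + b = (c *: x) *m M.
  by rewrite qE q0 subr0 scalemxAl.
exists c, p, M; split=> //; first by rewrite pr exprVn mulfV // expf_neq0.
split=> //; apply/seteqP; split=> X.
  move=> [[x xC <-]]; rewrite /unit_ball /= b0 (enorm_isometry MM) => x1.
  by exists (c *: x) => //; split=> //; exists x.
move=> [_ [[x xC <-] x1] <-]; split; first by exists x; rewrite ?b0.
by move: x1; rewrite /unit_ball /= (enorm_isometry MM).
Qed.

(** * The slope at the boundary and the existence of a free boundary catenoid *)

Lemma free_boundary_param_unique {R : realType} {m : R} {Z : R -> R} {p q : R} :
  0 < m -> is_height m Z -> 0 < p -> 0 < q ->
  p * Z p = radius m p -> q * Z q = radius m q -> p = q.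
Proof.
move=> m0 hZ; wlog pq : p q / p < q => [H p0 q0 pE qE|p0 q0 pE qE].
  have [pq|qp|//] := ltgtP p q; first exact: H.
  by apply/esym/H.
have dZ := is_derive_height hZ; have [Z0 _] := hZ.
have drho (z : R) : is_derive z 1 (radius m) (z * speed m z) by exact: is_derive_radius.
have : p * Z p - radius m p < q * Z q - radius m q.
  apply: (@increasing_of_derive R (fun x => x * Z x - radius m x) Z) => //.
    by move=> z _; is_derive_by; ring.
  by move=> z /andP[pz _]; rewrite -Z0; apply: (height_incr m0 hZ); exact: lt_trans pz.
by rewrite pE qE !subrr ltxx.
Qed.

Lemma free_boundary_param_exists {R : realType} {m : R} {Z : R -> R} :
  0 < m -> is_height m Z -> exists2 p, 0 < p & p * Z p = radius m p.
Proof.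
move=> m0 hZ; have dZ := is_derive_height hZ; have [Z0 _] := hZ.
have drho (z : R) : is_derive z 1 (radius m) (z * speed m z) by exact: is_derive_radius.
pose h (x : R) : R := x * Z x - radius m x.
have dh (z : R) : is_derive z 1 h (Z z) by rewrite /h; is_derive_by; ring.
have h0 : h 0 = -1 by rewrite /h mul0r radius0 sub0r.
have Z1 : 0 < Z 1 by rewrite -Z0; exact: (height_incr m0 hZ).
(* Beyond 1 the derivative Z of [h] exceeds Z 1, so over a length d the function gains more than |h
   1| + 1 and becomes positive. *)
pose d := (`|h 1| + 1) / Z 1.
have d0 : 0 < d by rewrite divr_gt0 // ltr_wpDl.
have d1 : 1 < 1 + d by rewrite ltrDl.
have [x /andP[x1 _]] := mean_value h Z d1 (fun z _ => dh z).
have -> : 1 + d - 1 = d by ring.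
have dZ1 : Z 1 * d = `|h 1| + 1 by rewrite /d mulrC divfK // gt_eqF.
have : Z 1 * d < Z x * d by rewrite ltr_pM2r //; exact: (height_incr m0 hZ).
rewrite dZ1 => ? hE; have hd : 0 < h (1 + d).
  by have := ler_norm (- h 1); rewrite normrN; lra.
have [|||p /andP[p0 _] hp] := @continuous_IVT R h 0 (1 + d) 0.
- by lra.
- by move=> z; exact: is_derive_continuous (dh z).
- by rewrite h0 (ltW hd); apply/orP; left; apply/andP; split; lra.
exists p; last by apply/eqP; rewrite -subr_eq0; apply/eqP.
rewrite lt_neqAle p0 andbT; apply/eqP => p0'; move: hp; rewrite -p0' h0.
by lra.
Qed.

(** Distance from the origin increases with p > 0, so the points of the surface on a given sphere
    about the origin have a single slope up to sign. *)
Lemma origin_distsq_inj {R : realType} {m : R} {Z : R -> R} {p q : R} :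
  0 < m -> is_height m Z -> 0 <= p -> 0 <= q ->
  Z p ^+ 2 + radius m p ^+ 2 = Z q ^+ 2 + radius m q ^+ 2 -> p = q.
Proof.
move=> m0 hZ; wlog pq : p q / p < q => [H p0 q0 pqE|p0 q0 pqE].
  have [pq|qp|//] := ltgtP p q; first exact: H.
  by apply/esym/H.
have dZ := is_derive_height hZ; have [Z0 _] := hZ.
have drho (z : R) : is_derive z 1 (radius m) (z * speed m z) by exact: is_derive_radius.
suff : Z p ^+ 2 + radius m p ^+ 2 < Z q ^+ 2 + radius m q ^+ 2 by rewrite pqE ltxx.
apply: (@increasing_of_derive R (fun x => Z x ^+ 2 + radius m x ^+ 2)
  (fun x => 2 * speed m x * (Z x + x * radius m x))) => //.
  by move=> z _; is_derive_by; ring.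
move=> z /andP[pz _]; have z0 : 0 < z by exact: le_lt_trans pz.
have Zz : 0 < Z z by rewrite -Z0; exact: (height_incr m0 hZ).
rewrite mulr_gt0 ?addr_gt0 //; last by rewrite mulr_gt0 ?radius_gt0.
by rewrite (mulr_gt0 _ (speed_gt0 m z m0)).
Qed.

(** The profile has velocity speed p times (1, p w). When p Z p = rho p, rescaling the parameter by
    k = Z p / speed p turns this into the position vector (Z p, rho p w). *)
Lemma tangent_position {R : realType} {n : nat} {m c : R} {Z : R -> R} (p : R)
    (w : 'rV[R]_n) : 0 < m -> is_height m Z -> enorm w = 1 ->
  p * Z p = radius m p ->
  let x := c *: axis_point (Z p) (radius m p *: w) in
  tangent [set c *: y | y in catenoid_surface n m Z] x x.
Proof.
move=> m0 hZ w1 pE x; pose k := Z p / speed m p.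
have s0 : speed m p != 0 by rewrite gt_eqF ?speed_gt0.
pose s (t : R) := p + t * k.
exists (fun t => c *: axis_point (Z (s t)) (radius m (s t) *: w)); split.
- by rewrite /s mul0r addr0.
- by near=> t; exists (axis_point (Z (s t)) (radius m (s t) *: w)) => //;
     exists (s t), w.
have ds : is_derive (0 : R) 1 s k by rewrite /s; is_derive_by; ring.
have s0E : s 0 = p by rewrite /s mul0r addr0.
have dZs := is_derive_comp (is_derive_height hZ (s 0)) ds.
have drs := is_derive_comp (is_derive_radius m (s 0) m0) ds.
apply/is_derive_row; apply: axis_pointP => [|j].
  have -> : (fun t => (c *: axis_point (Z (s t)) (radius m (s t) *: w)) 0
      (@lshift 1 n 0)) = (fun t => c * Z (s t)).
    by apply/funext => t; rewrite mxE axis_pointEl.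
  by rewrite /x mxE axis_pointEl; is_derive_by; rewrite s0E /k; field.
have -> : (fun t => (c *: axis_point (Z (s t)) (radius m (s t) *: w)) 0
    (@rshift 1 n j)) = (fun t => c * (radius m (s t) * w 0 j)).
  by apply/funext => t; rewrite mxE axis_pointEr mxE.
rewrite /x mxE axis_pointEr mxE -pE; is_derive_by; rewrite s0E /k; field.
exact: s0.
Unshelve. all: by end_near. Qed.

Lemma free_boundary_catenoid_exists {R : realType} {n : nat} {Z : R -> R} :
  (2 <= n)%N -> is_height (n%:R - 1) Z ->
  exists Sigma : set 'rV[R]_n.+1, free_boundary_catenoid Sigma.
Proof.
move=> n2 hZ; have maxT := maximal_profile_exists n2 hZ.
set m : R := n%:R - 1 in hZ maxT.
have m0 : 0 < m by rewrite subr_gt0 ltr1n.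
have [p p0 pE] := free_boundary_param_exists m0 hZ.
pose D (q : R) := Z q ^+ 2 + radius m q ^+ 2.
have D_gt0 : 0 < D p by rewrite ltr_wpDl ?sqr_ge0 ?exprn_gt0 ?radius_gt0.
(* This dilation puts the points of slope p on the unit sphere. *)
pose c := (Num.sqrt (D p))^-1; have c0 : 0 < c by rewrite invr_gt0 sqrtr_gt0.
have cD : c ^+ 2 * D p = 1 by rewrite exprVn sqr_sqrtr ?mulVf ?gt_eqF ?ltW.
have dotD (q : R) (w : 'rV[R]_n) : enorm w = 1 ->
    dot (c *: axis_point (Z q) (radius m q *: w))
      (c *: axis_point (Z q) (radius m q *: w)) = c ^+ 2 * D q.
  by move=> /enorm1P w1; rewrite !dotE dot_axis_point !dotE w1 /D; ring.
pose S : set 'rV[R]_n.+1 := [set c *: y | y in catenoid_surface n m Z].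
exists (S `&` @unit_ball R n.+1), S; split=> //.
- exists (half_length Z), (fun z => radius m (inverse Z z)), c.
  exists (idfun : {linear 'rV[R]_n.+1 -> 'rV[R]_n.+1}), 0; split=> //.
  rewrite (profile_catenoidE n2 hZ maxT); apply: eq_imagel => x _.
  by rewrite addr0.
- move=> _ [_ [q [w [w1 ->]]] <-] X1.
  (* It suffices that the position vector is tangent to S. Points of S on the sphere have slope p or
     -p, and the equation p Z p = rho p is even in p. *)
  apply/(meet_orthogonally_sphereP _ _ X1) => u Su; apply: Su.
  apply: (tangent_position q w m0 hZ w1).
  have /enorm1P := X1; rewrite (dotD q w w1) -cD => /mulfI Dq.
  have {}Dq : D q = D p by apply: Dq; rewrite expf_neq0 // gt_eqF.
  have [q0|q0] := leP 0 q.
    by rewrite (origin_distsq_inj m0 hZ q0 (ltW p0) Dq).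
  have Nq0 : 0 <= - q by rewrite oppr_ge0 ltW.
  have qE : - q = p.
    apply: (origin_distsq_inj m0 hZ Nq0 (ltW p0)).
    by rewrite (heightN hZ) sqrrN radiusN.
  by rewrite -[q]opprK qE (heightN hZ) radiusN mulrNN.
have [w [w1 _]] := exists_unit_orthogonal (0 : 'rV[R]_n) n2.
exists (c *: axis_point (Z p) (radius m p *: w)); split.
  by exists (axis_point (Z p) (radius m p *: w)) => //; exists p, w.
by rewrite /unit_ball /= /enorm (dotD p w w1) cD sqrtr1.
Qed.

Theorem theorem2 (R : realType) (n : nat) (hn : (2 <= n)%N) :
  (exists Sigma : set 'rV[R]_n.+1, free_boundary_catenoid Sigma) /\
  (forall Sigma1 Sigma2 : set 'rV[R]_n.+1,
     free_boundary_catenoid Sigma1 -> free_boundary_catenoid Sigma2 ->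
     exists L : {linear 'rV[R]_n.+1 -> 'rV[R]_n.+1},
       linear_isometry L /\ Sigma2 = L @` Sigma1).
Proof.
have m0 : 0 < n%:R - 1 :> R by rewrite subr_gt0 ltr1n.
have [Z hZ] := is_height_exists _ m0.
split; first exact: free_boundary_catenoid_exists hn hZ.
move=> S1 S2 /(free_boundary_normal_form hn hZ)[c1 [p1 [M1 [c10 p10 p1E c1D [M1M ->]]]]].
move=> /(free_boundary_normal_form hn hZ)[c2 [p2 [M2 [c20 p20 p2E c2D [M2M ->]]]]].
have p12 := free_boundary_param_unique m0 hZ p10 p20 p1E p2E.
have c12 : c1 = c2.
  have D0 : Z p2 ^+ 2 + radius (n%:R - 1) p2 ^+ 2 != 0.
    by apply: contra_eq_neq c2D => ->; rewrite mulr0 eq_sym oner_eq0.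
  apply/eqP; rewrite -(@eqrXn2 _ 2) ?ltW //; apply/eqP/(mulIf D0).
  by rewrite c2D -p12 c1D.
(* Both sets are isometric images of one standard set; this map undoes the first isometry and
   applies the second. *)
exists (mulmxr (M1^T *m M2)); split.
  have M12 : (M1^T *m M2) *m (M1^T *m M2)^T = 1%:M.
    by rewrite trmx_mul trmxK mulmxA -(mulmxA M1^T) M2M mulmx1 isometry_trmx.
  by move=> x; exact: (enorm_isometry M12).
rewrite c12 image_comp; apply: eq_imagel => x _ /=.
by rewrite !mulmxA -(mulmxA x) M1M mulmx1.
Qed.
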